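(* Let $a,b\in\mathbb{N}$ be such that $\mathcal{A}=\left(\frac{-a,-b}{\mathbb{Q}}\right)$ is a division algebra, and let $H$ be an order in $\mathcal{A}$ with $\mathbb{Z}$-basis $\{1,v_1,v_2,v_3\}$, where $v_r=a_{r,0}+a_{r,1}i+a_{r,2}j+a_{r,3}k$ for $r=1,2,3$. Let $d=(1+a)(1+b)$ and $M=\max_{1\le r\le3,\,0\le s\le3}|a_{r,s}|$. Then $H$ is a left principal ideal domain if and only if, for every prime $p<\lceil 2M(1+\sqrt{1+3d})\rceil^3$ and every nonzero $\delta=d_0+d_1v_1+d_2v_2+d_3v_3$ with $d_0,\dots,d_3\in\mathbb{Z}$, $d_0\ge0$, $|d_i|\le\frac{p}{2}$ for all $i$, and $p\mid\mathrm{N}(\delta)$, setting $\rho=\frac{\delta}{p}$, there exist $\alpha=a_0+a_1v_1+a_2v_2+a_3v_3$ with $a_i\in\mathbb{Z}$, $|a_i|\le\frac{p}{2}$, and $\beta\in H$ such that $0<\mathrm{N}(\alpha\rho-\beta)<1$.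
   Context: $\mathcal{A}$ has $\mathbb{Q}$-basis $1,i,j,k$ with $i^2=-a$, $j^2=-b$, $k=ij=-ji$, and norm $\mathrm{N}(x_0+x_1i+x_2j+x_3k)=x_0^2+ax_1^2+bx_2^2+abx_3^2$. An order is a subring containing $1$ that is a finitely generated $\mathbb{Z}$-module spanning $\mathcal{A}$ over $\mathbb{Q}$; a left principal ideal domain is one in which every left ideal is of the form $H\gamma$. *)

(* Defs.v *)
From HB Require Import structures.
From mathcomp Require Import all_boot all_order all_algebra.
From mathcomp Require Import ring.
From mathcomp Require Import boolp classical_sets reals.

Set Implicit Arguments.
Unset Strict Implicit.
Unset Printing Implicit Defensive.

Import Order.TTheory GRing.Theory Num.Theory.
Local Open Scope ring_scope.

(* [quat a b] is the quaternion algebra (-a, -b / Q); a quaternion is given by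
   its coordinates on 1, i, j, k, where i^2 = -a, j^2 = -b, k = ij = -ji. *)
Record quat (a b : nat) := Quat { q0 : rat; q1 : rat; q2 : rat; q3 : rat }.

Section QuatAlgebra.
Variables a b : nat.
Implicit Types x y z : quat a b.

Definition quat_to_prod x := (q0 x, q1 x, q2 x, q3 x).
Definition quat_of_prod (t : rat * rat * rat * rat) : quat a b :=
  let: (t0, t1, t2, t3) := t in Quat a b t0 t1 t2 t3.

Lemma quat_to_prodK : cancel quat_to_prod quat_of_prod.
Proof. by case. Qed.

HB.instance Definition _ := Choice.copy (quat a b) (can_type quat_to_prodK).

Lemma quatP x y :
  [/\ q0 x = q0 y, q1 x = q1 y, q2 x = q2 y & q3 x = q3 y] -> x = y.
Proof. by case: x y => [????] [????] [/= -> -> -> ->]. Qed.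

Definition quat_zero : quat a b := Quat a b 0 0 0 0.
Definition quat_one : quat a b := Quat a b 1 0 0 0.
Definition quat_opp x : quat a b := Quat a b (- q0 x) (- q1 x) (- q2 x) (- q3 x).
Definition quat_add x y : quat a b :=
  Quat a b (q0 x + q0 y) (q1 x + q1 y) (q2 x + q2 y) (q3 x + q3 y).
Definition quat_scale (c : rat) x : quat a b :=
  Quat a b (c * q0 x) (c * q1 x) (c * q2 x) (c * q3 x).
Definition quat_mul x y : quat a b :=
  Quat a b
    (q0 x * q0 y - a%:R * (q1 x * q1 y) - b%:R * (q2 x * q2 y)
       - a%:R * b%:R * (q3 x * q3 y))
    (q0 x * q1 y + q1 x * q0 y + b%:R * (q2 x * q3 y) - b%:R * (q3 x * q2 y))
    (q0 x * q2 y + q2 x * q0 y - a%:R * (q1 x * q3 y) + a%:R * (q3 x * q1 y))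
    (q0 x * q3 y + q3 x * q0 y + q1 x * q2 y - q2 x * q1 y).

Fact quat_addA : associative quat_add.
Proof. by move=> x y z; apply: quatP; split; rewrite /= addrA. Qed.
Fact quat_addC : commutative quat_add.
Proof. by move=> x y; apply: quatP; split; rewrite /= addrC. Qed.
Fact quat_add0 : left_id quat_zero quat_add.
Proof. by move=> x; apply: quatP; split; rewrite /= add0r. Qed.
Fact quat_addN : left_inverse quat_zero quat_opp quat_add.
Proof. by move=> x; apply: quatP; split; rewrite /= addNr. Qed.

HB.instance Definition _ := GRing.isZmodule.Build (quat a b)
  quat_addA quat_addC quat_add0 quat_addN.

Fact quat_mulA : associative quat_mul.
Proof. by move=> x y z; apply: quatP; split => /=; ring. Qed.
Fact quat_mul1 : left_id quat_one quat_mul.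
Proof. by move=> x; apply: quatP; split => /=; ring. Qed.
Fact quat_mulr1 : right_id quat_one quat_mul.
Proof. by move=> x; apply: quatP; split => /=; ring. Qed.
Fact quat_mulDl : left_distributive quat_mul quat_add.
Proof. by move=> x y z; apply: quatP; split => /=; ring. Qed.
Fact quat_mulDr : right_distributive quat_mul quat_add.
Proof. by move=> x y z; apply: quatP; split => /=; ring. Qed.
Fact quat_oner_neq0 : quat_one != quat_zero.
Proof. by apply/eqP => -[]. Qed.

HB.instance Definition _ := GRing.Zmodule_isNzRing.Build (quat a b)
  quat_mulA quat_mul1 quat_mulr1 quat_mulDl quat_mulDr quat_oner_neq0.

Fact quat_scaleA (c d : rat) x :
  quat_scale c (quat_scale d x) = quat_scale (c * d) x.
Proof. by apply: quatP; split; rewrite /= mulrA. Qed.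
Fact quat_scale1 : left_id 1 quat_scale.
Proof. by move=> x; apply: quatP; split; rewrite /= mul1r. Qed.
Fact quat_scaleDr : right_distributive quat_scale +%R.
Proof. by move=> c x y; apply: quatP; split; rewrite /= mulrDr. Qed.
Fact quat_scaleDl x : {morph quat_scale^~ x : c d / c + d}.
Proof. by move=> c d; apply: quatP; split; rewrite /= mulrDl. Qed.

HB.instance Definition _ := GRing.Zmodule_isLmodule.Build rat (quat a b)
  quat_scaleA quat_scale1 quat_scaleDr quat_scaleDl.

Fact quat_scaleAl (c : rat) x y : c *: (x * y) = (c *: x) * y.
Proof. by apply: quatP; split => /=; ring. Qed.
HB.instance Definition _ :=
  GRing.Lmodule_isLalgebra.Build rat (quat a b) quat_scaleAl.

Fact quat_scaleAr (c : rat) x y : c *: (x * y) = x * (c *: y).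
Proof. by apply: quatP; split => /=; ring. Qed.
HB.instance Definition _ :=
  GRing.Lalgebra_isAlgebra.Build rat (quat a b) quat_scaleAr.

Definition qi : quat a b := Quat a b 0 1 0 0.
Definition qj : quat a b := Quat a b 0 0 1 0.
Definition qk : quat a b := Quat a b 0 0 0 1.

Lemma qi_sqr : qi ^+ 2 = (- a%:R)%:A.
Proof. by apply: quatP; split => /=; ring. Qed.
Lemma qj_sqr : qj ^+ 2 = (- b%:R)%:A.
Proof. by apply: quatP; split => /=; ring. Qed.
Lemma qij : qi * qj = qk.
Proof. by apply: quatP; split => /=; ring. Qed.
Lemma qji : qj * qi = - qk.
Proof. by apply: quatP; split => /=; ring. Qed.
Lemma quatE x : x = (q0 x)%:A + q1 x *: qi + q2 x *: qj + q3 x *: qk.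
Proof. by apply: quatP; split => /=; ring. Qed.

Definition qnorm x : rat :=
  q0 x ^+ 2 + a%:R * q1 x ^+ 2 + b%:R * q2 x ^+ 2 + (a * b)%:R * q3 x ^+ 2.

End QuatAlgebra.

Definition division_ring (A : nzRingType) : Prop :=
  forall x : A, x != 0 -> exists y : A, y * x = 1 /\ x * y = 1.

Section Orders.
Local Open Scope classical_set_scope.

Definition zcomb (A : zmodType) (n : nat) (e : 'I_n -> A) (z : 'I_n -> int) : A :=
  \sum_(i < n) e i *~ z i.

Definition zbasis (A : zmodType) (H : set A) (n : nat) (e : 'I_n -> A) : Prop :=
  H = range (zcomb e) /\
  (forall z : 'I_n -> int, zcomb e z = 0 -> forall i, z i = 0).

Definition is_subring (A : nzRingType) (H : set A) : Prop :=
  [/\ H 1, forall x y, H x -> H y -> H (x - y)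
    & forall x y, H x -> H y -> H (x * y)].

Definition zfin_gen (A : zmodType) (H : set A) : Prop :=
  exists (n : nat) (e : 'I_n -> A), H = range (zcomb e).

Definition qspanning (A : lmodType rat) (H : set A) : Prop :=
  forall x : A, exists (n : nat) (c : 'I_n -> rat) (h : 'I_n -> A),
    (forall i, H (h i)) /\ x = \sum_(i < n) c i *: h i.

Definition is_order (A : algType rat) (H : set A) : Prop :=
  [/\ is_subring H, zfin_gen H & qspanning H].

Definition left_ideal (A : nzRingType) (H I : set A) : Prop :=
  [/\ I `<=` H, I 0, forall x y, I x -> I y -> I (x + y)
    & forall h x, H h -> I x -> I (h * x)].

Definition left_PID (A : nzRingType) (H : set A) : Prop :=
  (forall x y, H x -> H y -> x * y = 0 -> x = 0 \/ y = 0) /\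
  (forall I : set A, left_ideal H I ->
    exists g : A, H g /\ I = [set h * g | h in H]).

End Orders.

(* The family 1, v_1, v_2, v_3; [v ord0] is v_1. *)
Definition with_one (A : nzRingType) (v : 'I_3 -> A) (i : 'I_4) : A :=
  if unlift ord0 i is Some r then v r else 1.

(* The default 0 of the iterated maximum is harmless: the terms are >= 0. *)
Definition max_abs (m n : nat) (c : 'M[rat]_(m, n)) : rat :=
  \big[Num.max/0]_(r < m) \big[Num.max/0]_(s < n) `|c r s|.

(* Main.v *)
(* H is a left PID iff it satisfies the Dedekind-Hasse criterion: every rho
   outside H admits alpha, beta in H with 0 < N(alpha rho - beta) < 1.  In one
   direction, a generator of the left ideal H(n rho) + Hn has norm less than
   N(n) unless rho is in H; in the other, a nonzero element of minimal norm
   generates a left ideal.  Up to multiplication by an integer and translation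
   by H one may take rho = delta / p with p prime and delta reduced mod p.  If p
   does not divide N(delta), multiplying by the conjugate of delta gives a
   non-integral rational number.  If p is at least the cube L^3 of the statement,
   Dirichlet's simultaneous approximation yields 0 < q <= L^3 < p such that the
   coordinates of q rho on v_1, v_2, v_3 are within 1/L of integers, and the
   choice of L forces the norm of the difference to be less than 1. *)

Require Import Defs.
From mathcomp Require Import all_boot all_order all_algebra.
From mathcomp Require Import boolp classical_sets reals.
From mathcomp Require Import archimedean ring lra zify.

Set Implicit Arguments.
Unset Strict Implicit.
Unset Printing Implicit Defensive.

Import Order.TTheory GRing.Theory Num.Theory.
Local Open Scope ring_scope.

(** * Integrality, simultaneous approximation and residues *)

(** In lowest terms [denq r ^ n] is coprime to [numq r ^ n], so it divides [D] for every [n]; a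
    denominator above 1 would outgrow [D]. *)
Lemma rat_int_of_bounded_powers (D : int) (r : rat) :
  D != 0 -> (forall n, D%:~R * r ^+ n \is a Num.int) -> r \is a Num.int.
Proof.
move=> D0 hD; rewrite Qint_def; apply/eqP; move: (denq_gt0 r) => dgt0.
have dv n : (denq r ^+ n %| D)%Z.
  have /intrP[m hm] := hD n.
  have hm' : D * numq r ^+ n = m * denq r ^+ n.
    apply: (@intr_inj rat); rewrite !rmorphM /= !rmorphXn /= -hm -mulrA -exprMn.
    by rewrite -numqE.
  rewrite -(@Gauss_dvdzl _ _ (numq r ^+ n)); first by rewrite hm' dvdz_mull.
  rewrite coprimezE !abszX coprimeXl // coprimeXr // coprime_sym.
  exact: coprime_num_den.
have d1 : (`|denq r| <= 1)%N.
  rewrite leqNgt; apply/negP => d2.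
  have := dv `|D|%N; rewrite dvdzE abszX => /dvdn_leq.
  rewrite lt0n absz_eq0 D0 => /(_ isT).
  by rewrite leqNgt (leq_trans (ltn_expl _ d2)).
lia.
Qed.

(** Pigeonhole: the fractional parts of the [L ^ n + 1] multiples [k * f] fall into [L ^ n] boxes of
    side [1 / L]; two in one box give [q] as the difference of their indices. *)
Lemma dirichlet_simultaneous (n L : nat) (f : 'I_n -> rat) : (0 < L)%N ->
  exists (q : nat) (m : 'I_n -> int),
    (0 < q <= L ^ n)%N /\ forall i, `|q%:R * f i - (m i)%:~R| < L%:R^-1.
Proof.
case: L => // L _.
pose fr (k : nat) i := k%:R * f i - (Num.floor (k%:R * f i))%:~R.
have fr0 k i : 0 <= fr k i by rewrite subr_ge0 floor_le.
have fr1 k i : fr k i < 1 by have := floorD1_gt (k%:R * f i); rewrite rmorphD /= ltrBlDl.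
pose g (k : 'I_(L.+1 ^ n).+1) : {ffun 'I_n -> 'I_L.+1} :=
  [ffun i => inord (Num.truncn (L.+1%:R * fr k i))].
have [k1 [k2 [k12 gk]]] : exists k1 k2 : 'I_(L.+1 ^ n).+1, (k1 < k2)%N /\ g k1 = g k2.
  have /injectivePn[x [y xy gxy]] : ~~ injectiveb g.
    apply/injectiveP => /leq_card; rewrite card_ffun !card_ord ltnn //.
  by case: (ltngtP x y) => [h|h|/val_inj h]; [exists x, y|exists y, x|
    rewrite h eqxx in xy].
exists (k2 - k1)%N, (fun i => Num.floor (k2%:R * f i) - Num.floor (k1%:R * f i)).
split; first by rewrite subn_gt0 k12 (leq_trans (leq_subr _ _)) // -ltnS.
move=> i; have L0 : 0 < L.+1%:R :> rat by [].
rewrite natrB ?(ltnW k12)// rmorphB /= mulrBl.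
have -> : forall x y u w : rat, x - y - (u - w) = (x - u) - (y - w) by move=> *; ring.
rewrite -/(fr k2 i) -/(fr k1 i) -div1r ltr_pdivlMr //.
rewrite -[X in _ * X](ger0_norm (ltW L0)) -normrM.
(* This bound ensures that [inord] keeps the box number instead of returning its default. *)
have bnd k : (Num.truncn (L.+1%:R * fr k i) < L.+1)%N.
  rewrite -(ltr_nat rat); apply: le_lt_trans (_ : L.+1%:R * fr k i < _).
    by rewrite truncn_le mulr_ge0.
  by rewrite gtr_pMr.
have /(congr1 (@nat_of_ord _)) := congr1 (fun h : {ffun _} => h i) gk.
rewrite !ffunE !inordK ?bnd // => tk.
have hb k : (Num.truncn (L.+1%:R * fr k i))%:R <= L.+1%:R * fr k i <
    (Num.truncn (L.+1%:R * fr k i)).+1%:R.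
  by apply: truncn_itv; rewrite mulr_ge0.
have := hb k1; have := hb k2; rewrite tk -natr1.
move: (_%:R) (fr k1 i) (fr k2 i) => T x y /andP[h1 h2] /andP[h3 h4].
by rewrite ltr_norml; apply/andP; split; lra.
Qed.

Definition centered_mod (p : nat) (z : int) : int :=
  let r := (z %% p)%Z in if 2 * r <= p then r else r - p%:Z.

Lemma centered_modE p z : exists k : int, z = centered_mod p z + p%:Z * k.
Proof.
rewrite /centered_mod; case: ifP => _.
  by exists (z %/ p)%Z; rewrite [LHS](divz_eq z p); ring.
by exists ((z %/ p)%Z + 1); rewrite [LHS](divz_eq z p); ring.
Qed.

Lemma centered_mod_le p z : (0 < p)%N ->
  `|centered_mod p z|%:~R <= p%:R / 2 :> rat.
Proof.
move=> p0; rewrite ler_pdivlMr // -[2]/(2%:~R) -intrM -[p%:R]/(p%:~R) ler_int.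
rewrite mulrC -[X in X * _](@ger0_norm _ 2) // -normrM /centered_mod.
have pz : p%:Z != 0 by rewrite -lt0n.
have := @ltz_pmod z p p0; have := modz_ge0 z pz.
move: (z %% p)%Z (Posz p) => r P r0 rP.
by case: ifP => [h|/negbT]; rewrite ?lter_norml -?ltNge; lia.
Qed.

(* The bound on [L] makes [3 M / L] at most the positive root of d t^2 + t = 3/4. *)
Lemma quadratic_lt_of_sqrt_bound (R : realType) (d L : nat) (M t : rat) :
  0 < M -> 0 <= t -> t * L%:R < 3 * M ->
  2 * ratr M * (1 + Num.sqrt (1 + 3 * d%:R)) <= L%:R :> R ->
  t + d%:R * t ^+ 2 < 3 / 4.
Proof.
move=> M0 t0 tL hL; rewrite -(ltr_rat R).
have M0' : 0 < ratr M :> R by rewrite ltr0q.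
have t0' : 0 <= ratr t :> R by rewrite ler0q.
have tL' : ratr t * L%:R < 3 * ratr M :> R.
  by move: tL; rewrite -(ltr_rat R) !rmorphM /= !ratr_nat.
rewrite rmorphD rmorphM rmorphXn /= fmorph_div !ratr_nat.
move: (ratr M) (ratr t) (L%:R : R) M0' t0' tL' hL => {}M {}t {}L {}M0 {}t0 {}tL.
have d0 : 0 <= d%:R :> R by [].
set s := Num.sqrt _.
have s0 : 0 <= s by exact: sqrtr_ge0.
have s2 : s ^+ 2 = 1 + 3 * d%:R by rewrite sqr_sqrtr //; lra.
move: s (d%:R : R) s0 s2 d0 => s D s0 s2 D0 hL.
(* Multiply [hL] by [t], use [tL] and cancel [M]; squaring the result then gives
   [12 * (t + D * t ^ 2) < 9]. *)
have h : 2 * t * s < 3 - 2 * t.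
  suff : M * (2 * t * (1 + s)) < M * 3 by rewrite ltr_pM2l //; lra.
  have := ler_wpM2l t0 hL; lra.
have : (2 * t * s) ^+ 2 < (3 - 2 * t) ^+ 2.
  by rewrite ltrXn2r // ?nnegrE ?mulr_ge0 //; apply: le_trans (ltW h); rewrite !mulr_ge0.
rewrite exprMn s2; lra.
Qed.

(** * The norm form *)

Section QuatNorm.
Variables a b : nat.
Implicit Types x y : quat a b.

Definition qconj x : quat a b := Quat a b (q0 x) (- q1 x) (- q2 x) (- q3 x).

Lemma mulq_conjl x : qconj x * x = (qnorm x)%:A.
Proof. by apply: quatP; split; rewrite /qnorm /=; ring. Qed.

Lemma qnorm_mul x y : qnorm (x * y) = qnorm x * qnorm y.
Proof. by rewrite /qnorm /=; ring. Qed.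

Lemma qnorm_scale (t : rat) x : qnorm (t *: x) = t ^+ 2 * qnorm x.
Proof. by rewrite /qnorm /=; ring. Qed.

Lemma qnorm1 : qnorm (1 : quat a b) = 1.
Proof. by rewrite /qnorm /=; ring. Qed.

Lemma qnorm_exp x n : qnorm (x ^+ n) = qnorm x ^+ n.
Proof. by elim: n => [|n IH]; rewrite ?qnorm1 // !exprS qnorm_mul IH. Qed.

Lemma qnorm_ge0 x : 0 <= qnorm x.
Proof. by rewrite /qnorm !addr_ge0 ?sqr_ge0 // mulr_ge0 ?sqr_ge0. Qed.

(** The form is only semidefinite when [a] or [b] is 0; positivity comes from multiplicativity
    applied to an inverse of [x]. *)
Lemma division_qnorm_gt0 x : division_ring (quat a b) -> x != 0 -> 0 < qnorm x.
Proof.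
move=> hd x0; rewrite lt_def qnorm_ge0 andbT; apply/eqP => nx.
have [y [yx _]] := hd _ x0; have := qnorm1.
by rewrite -yx qnorm_mul nx mulr0 => /eqP; rewrite eq_sym oner_eq0.
Qed.

(** The squares add up to at most [(1/2 + t)^2 + (a + b + a b) t^2 = 1/4 + t + (1 + a)(1 + b) t^2],
    which is the origin of [d]. *)
Lemma qnorm_lt1 x (t : rat) :
  `|q0 x| <= 2^-1 + t -> `|q1 x| <= t -> `|q2 x| <= t -> `|q3 x| <= t ->
  t + ((1 + a) * (1 + b))%N%:R * t ^+ 2 < 3 / 4 -> qnorm x < 1.
Proof.
have sq (y s : rat) : `|y| <= s -> y ^+ 2 <= s ^+ 2.
  move=> ys; rewrite -real_normK ?num_real // lerXn2r // ?nnegrE //.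
  exact: le_trans ys.
move=> /sq h0 /sq h1 /sq h2 /sq h3 ht; rewrite /qnorm.
have := ler_wpM2l (ler0n rat a) h1; have := ler_wpM2l (ler0n rat b) h2.
have := ler_wpM2l (ler0n rat (a * b)) h3.
have e2 : (2^-1 + t) ^+ 2 = 4^-1 + t + t ^+ 2 by field.
rewrite e2 in h0.
move: ht; rewrite !natrM !natrD; lra.
Qed.

End QuatNorm.

(** * Integral combinations, subrings and common denominators *)

Section ZComb.
Variables (A : zmodType) (n : nat) (e : 'I_n -> A).

Lemma zcombD z w : zcomb e (fun i => z i + w i) = zcomb e z + zcomb e w.
Proof. by rewrite /zcomb -big_split /=; apply: eq_bigr => i _; rewrite mulrzDr. Qed.

Lemma zcombM (k : int) z : zcomb e (fun i => k * z i) = zcomb e z *~ k.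
Proof. by rewrite /zcomb mulrz_suml; apply: eq_bigr => i _; rewrite mulrC mulrzA. Qed.

Lemma zcomb_inj H : zbasis H e -> forall z w, zcomb e z = zcomb e w -> z =1 w.
Proof.
move=> [_ he] z w zw i; apply/eqP; rewrite -subr_eq0; apply/eqP.
apply: (he (fun i => z i - w i)).
have -> : (fun i => z i - w i) = (fun i => z i + -1 * w i).
  by apply/funext => j; rewrite mulN1r.
by rewrite zcombD zcombM mulrN1z zw subrr.
Qed.

End ZComb.

Section Subring.
Variables (A : nzRingType) (H : set A).
Hypothesis hH : is_subring H.

Lemma subring0 : H 0.
Proof. by case: hH => h1 hB _; rewrite -(subrr 1); apply: hB. Qed.
Lemma subringN x : H x -> H (- x).
Proof. by case: hH => _ hB _ hx; rewrite -sub0r; apply: hB => //; exact: subring0. Qed.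
Lemma subringD x y : H x -> H y -> H (x + y).
Proof. by case: (hH) => _ hB _ hx hy; rewrite -[y]opprK;
apply: hB => //; exact: subringN. Qed.
Lemma subringM x y : H x -> H y -> H (x * y).
Proof. by case: hH => _ _; apply. Qed.
Lemma subringMz x k : H x -> H (x *~ k).
Proof.
move=> hx; have hn n : H (x *+ n).
  by elim: n => [|n IH]; rewrite ?mulr0n ?mulrS; [exact: subring0 | exact: subringD].
by case: k => n; [exact: hn|rewrite NegzE mulrNz; apply/subringN/hn].
Qed.
Lemma subringX x n : H x -> H (x ^+ n).
Proof.
by case: (hH) => h1 _ _ hx; elim: n => [//|n IH]; rewrite exprS; exact: subringM.
Qed.
Lemma subring_sum (n : nat) (f : 'I_n -> A) : (forall i, H (f i)) -> H (\sum_(i < n) f i).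
Proof. by move=> hf; apply: big_ind => //; [exact: subring0|exact: subringD]. Qed.

End Subring.

Lemma common_denominator (n : nat) (f : 'I_n -> rat) :
  exists2 D : nat, (0 < D)%N & forall i, D%:R * f i \is a Num.int.
Proof.
exists (\prod_i `|denq (f i)|)%N.
  by apply: prodn_gt0 => i; rewrite absz_gt0 denq_neq0.
move=> i; rewrite (bigD1 i) //= mulnC natrM -mulrA; apply: rpredM; first exact: natr_int.
suff -> : `|denq (f i)|%N%:R * f i = (numq (f i))%:~R by exact: intr_int.
by rewrite numqE mulrC pmulrn absz_denq.
Qed.

(** * Norms, conjugates and denominators in an order *)

Section Order.
Variables (a b : nat) (H : set (quat a b)).
Hypothesis hH : is_order H.

(* The norms of all powers of [x] have a common denominator, since the
   coordinates of the elements of [H] do. *)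
Lemma order_qnorm_int x : H x -> qnorm x \is a Num.int.
Proof.
case: hH => hs [n [e eH]] _ hx.
have [D0 D0_gt0 hD0] := common_denominator (fun i => q0 (e i)).
have [D1 D1_gt0 hD1] := common_denominator (fun i => q1 (e i)).
have [D2 D2_gt0 hD2] := common_denominator (fun i => q2 (e i)).
have [D3 D3_gt0 hD3] := common_denominator (fun i => q3 (e i)).
have natM (k : nat) (y : rat) : y \is a Num.int -> k%:R * y \is a Num.int.
  by move=> hy; apply: rpredM => //; exact: natr_int.
pose D := (D0 * D1 * D2 * D3)%N.
have hD h : H h -> D%:R ^+ 2 * qnorm h \is a Num.int.
  rewrite eH => -[z _ <-].
  suff [z0 z1 z2 z3] : [/\ D%:R * q0 (zcomb e z) \is a Num.int,
    D%:R * q1 (zcomb e z) \is a Num.int, D%:R * q2 (zcomb e z) \is a Num.int &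
    D%:R * q3 (zcomb e z) \is a Num.int].
    have -> : D%:R ^+ 2 * qnorm (zcomb e z) = (D%:R * q0 (zcomb e z)) ^+ 2 +
      a%:R * (D%:R * q1 (zcomb e z)) ^+ 2 + b%:R * (D%:R * q2 (zcomb e z)) ^+ 2 +
      (a * b)%:R * (D%:R * q3 (zcomb e z)) ^+ 2 by rewrite /qnorm; ring.
    by do ?apply: rpredD; [exact: rpredX | apply/natM/rpredX ..].
  rewrite /zcomb; apply: (big_ind (fun y => [/\ D%:R * q0 y \is a Num.int,
    D%:R * q1 y \is a Num.int, D%:R * q2 y \is a Num.int & D%:R * q3 y \is a Num.int])).
  - by rewrite /= mulr0.
  - by move=> x1 x2 [? ? ? ?] [? ? ? ?]; rewrite /= !mulrDr; split; apply: rpredD.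
  move=> i _; rewrite -scaler_int /= !(mulrCA D%:R) /D !natrM.
  split; apply: (rpredM (intr_int _ _)).
  - have -> : D0%:R * D1%:R * D2%:R * D3%:R * q0 (e i) =
      D1%:R * (D2%:R * (D3%:R * (D0%:R * q0 (e i)))) by ring.
    by apply/natM/natM/natM.
  - have -> : D0%:R * D1%:R * D2%:R * D3%:R * q1 (e i) =
      D0%:R * (D2%:R * (D3%:R * (D1%:R * q1 (e i)))) by ring.
    by apply/natM/natM/natM.
  - have -> : D0%:R * D1%:R * D2%:R * D3%:R * q2 (e i) =
      D0%:R * (D1%:R * (D3%:R * (D2%:R * q2 (e i)))) by ring.
    by apply/natM/natM/natM.
  - have -> : D0%:R * D1%:R * D2%:R * D3%:R * q3 (e i) =
      D0%:R * (D1%:R * (D2%:R * (D3%:R * q3 (e i)))) by ring.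
    by apply/natM/natM/natM.
apply: (@rat_int_of_bounded_powers (D%:Z ^+ 2)).
  by rewrite expf_neq0 // -lt0n !muln_gt0 D0_gt0 D1_gt0 D2_gt0.
by move=> k; rewrite rmorphXn /= -qnorm_exp; exact: hD (subringX hs k hx).
Qed.

Lemma order_qnorm_nat x : H x -> exists n : nat, qnorm x = n%:R.
Proof.
move=> hx; have /intrP[m hm] := order_qnorm_int hx.
have := qnorm_ge0 x; rewrite hm ler0z; case: m hm => // n _ _.
by exists n.
Qed.

(* [qconj x = tr x - x] with [tr x = qnorm (1 + x) - qnorm x - 1]. *)
Lemma order_conj x : H x -> H (qconj x).
Proof.
move=> hx; case: (hH) => hs _ _; have [h1 hB _] := hs.
have /intrP[m hm] := order_qnorm_int hx.
have /intrP[k hk] := order_qnorm_int (subringD hs h1 hx).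
have -> : qconj x = 1 *~ (k - m - 1) - x; last by apply/hB => //; exact: subringMz.
rewrite -scaler_int !rmorphB /= -hk -hm.
by apply: quatP; split; rewrite /qnorm /=; ring.
Qed.

Lemma order_denominator x : exists2 n : nat, (0 < n)%N & H (n%:R *: x).
Proof.
case: hH => hs _ /(_ x)[n [t [h [hh ->]]]].
have [D D0 hD] := common_denominator t; exists D => //.
rewrite scaler_sumr; apply: subring_sum => // i.
by rewrite scalerA; have /intrP[m ->] := hD i; rewrite scaler_int; exact: subringMz.
Qed.

(** Take the least [n > 0] with [n * x] in [H], a prime factor [p] of [n], and [m = n / p];
    minimality keeps [m * x] outside [H]. *)
Lemma order_prime_denominator x : ~ H x ->
  exists p m : nat, [/\ prime p, ~ H (m%:R *: x) & H (p%:R *: (m%:R *: x))].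
Proof.
move=> nHx; have [n0 n00 hn0] := order_denominator x.
have ex : exists n, `[< (0 < n)%N /\ H (n%:R *: x) >] by exists n0; apply/asboolP.
case: (ex_minnP ex) => n /asboolP[n_gt0 hn] hmin.
have n1 : (1 < n)%N.
  by case: n n_gt0 hn {hmin} => [|[|n]] // _; rewrite scale1r.
exists (pdiv n), (n %/ pdiv n)%N; split; first exact: pdiv_prime.
  have lt_n : (n %/ pdiv n < n)%N by rewrite ltn_Pdiv ?prime_gt1 ?pdiv_prime.
  move=> hm; move: lt_n; rewrite ltnNge hmin //; apply/asboolP; split=> //.
  by rewrite divn_gt0 ?pdiv_gt0 // pdiv_leq.
by rewrite scalerA -natrM mulnC divnK ?pdiv_dvd.
Qed.

End Order.

(** * The Dedekind-Hasse criterion *)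

(** No size bound is put on [alpha] here; the bound of the theorem is recovered by reducing [alpha]
    modulo [p]. *)
Definition norm_reducible (a b : nat) (H : set (quat a b)) (rho : quat a b) :=
  exists alpha beta, [/\ H alpha, H beta & 0 < qnorm (alpha * rho - beta) < 1].

Section DedekindHasse.
Variables (a b : nat) (H : set (quat a b)).
Hypotheses (hdiv : division_ring (quat a b)) (hH : is_order H).

Let hs : is_subring H. Proof. by case: hH. Qed.

Lemma order_natr (n : nat) : H (n%:R%:A).
Proof. by have [h1 _ _] := hs; rewrite pmulrn scaler_int; exact: subringMz. Qed.

Lemma order_int_scale (k : int) x : H x -> H (k%:~R *: x).
Proof. by rewrite scaler_int; exact: subringMz. Qed.

(** Since [al (x rho + k) - be = (al x) rho - (be - al k)], it is enough to reduce a convenient left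
    multiple of [rho], translated by [H]. *)
Lemma norm_reducible_affine x k rho :
  H x -> H k -> norm_reducible H (x * rho + k) -> norm_reducible H rho.
Proof.
move=> hx hk [al [be [hal hbe hN]]]; exists (al * x), (be - al * k); split.
- exact: subringM.
- by have [_ hB _] := hs; apply: hB => //; exact: subringM.
by rewrite opprB addrA -mulrA -mulrDr.
Qed.

(** Norms on [H] are natural numbers, so a nonzero ideal has a nonzero element [g] of least norm. If
    [y * g^-1] were outside [H], reducing it and multiplying back by [g] would give a nonzero
    element of the ideal with smaller norm. *)
Lemma left_PID_of_norm_reducible :
  (forall rho, ~ H rho -> norm_reducible H rho) -> left_PID H.
Proof.
move=> hred; split.
  move=> x y _ _ xy; have [->|x0] := eqVneq x 0; [by left|right].
  have [z [zx _]] := hdiv x0.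
  by rewrite -[y]mul1r -zx -mulrA xy mulr0.
move=> I [IH I0 ID IM].
have [[x [Ix x0]]|hI] := pselect (exists x, I x /\ x != 0); last first.
  exists 0; split; first exact: subring0.
  apply/seteqP; split => [x Ix|_ [h _ <-]]; last by rewrite mulr0.
  exists 0; first exact: subring0.
  by rewrite mulr0; apply/esym/eqP/negPn/negP => x0; apply: hI; exists x.
have ex : exists n : nat, `[< exists y, [/\ I y, y != 0 & qnorm y = n%:R] >].
  by have [n hn] := order_qnorm_nat hH (IH _ Ix); exists n; apply/asboolP; exists x.
case: (ex_minnP ex) => n /asboolP[g [Ig g0 gn]] hmin.
exists g; split; first exact: IH.
apply/seteqP; split => [y Iy|_ [h hh <-]]; last exact: IM.
have [g' [g'g gg']] := hdiv g0.
have [hy|/hred[al [be [hal hbe /andP[N0 N1]]]]] := pselect (H (y * g')).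
  by exists (y * g') => //; rewrite -mulrA g'g mulr1.
have N1' : H (-1) by apply: subringN => //; case: hs.
(* The factor [-1] is taken as an element of [H], because [left_ideal] provides sums and left
   multiples but not differences. *)
pose w := al * y + -1 * (be * g).
have wE : w = (al * (y * g') - be) * g.
  by rewrite /w mulrBl mulN1r -!mulrA g'g mulr1.
have Iw : I w by apply: ID; [exact: IM | apply/(IM _ _ N1')/IM].
have [k hk] := order_qnorm_nat hH (IH _ Iw).
have n0 : 0 < n%:R :> rat by rewrite -gn; exact: division_qnorm_gt0.
have w0 : w != 0.
  apply: contraTneq N0 => w0; rewrite -leNgt.
  have := congr1 (@qnorm a b) wE; rewrite w0 qnorm_mul gn.
  have -> : qnorm (0 : quat a b) = 0 by rewrite /qnorm /=; ring.
  by move/esym/eqP; rewrite mulf_eq0 (gt_eqF n0) orbF => /eqP ->.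
have /hmin : `[< exists y, [/\ I y, y != 0 & qnorm y = k%:R] >].
  by apply/asboolP; exists w.
rewrite leqNgt -(ltr_nat rat) -hk wE qnorm_mul gn.
by rewrite gtr_pMl // N1.
Qed.

(* A generator of the left ideal H(n rho) + Hn has norm a proper divisor of n^2. *)
Lemma norm_reducible_of_left_PID (n : nat) rho : left_PID H -> (0 < n)%N ->
  H (n%:R *: rho) -> ~ H rho -> norm_reducible H rho.
Proof.
move=> [_ hP] n0 hn nrho.
have nn0 : n%:R != 0 :> rat by rewrite pnatr_eq0 -lt0n.
pose I : set (quat a b) := fun x => exists h k, [/\ H h, H k &
  x = h * (n%:R *: rho) + n%:R *: k].
have h1 : H 1 by case: hs.
have h0 : H 0 by exact: subring0.
have hnA k : H k -> H (n%:R *: k) by rewrite pmulrn; exact: order_int_scale.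
have hI : left_ideal H I.
  split.
  - move=> _ [h [k [hh hk ->]]]; apply: subringD => //; first exact: subringM.
    exact: hnA.
  - by exists 0, 0; split=> //; rewrite mul0r scaler0 addr0.
  - move=> _ _ [h [k [hh hk ->]]] [h' [k' [hh' hk' ->]]].
    exists (h + h'), (k + k'); split; [exact: subringD|exact: subringD|].
    by rewrite mulrDl scalerDr addrACA.
  - move=> u _ hu [h [k [hh hk ->]]]; exists (u * h), (u * k).
    by split; [exact: subringM|exact: subringM|rewrite mulrDr mulrA scalerAr].
have [g [hg Ig]] := hP I hI.
have [h [k [hh hk gE]]] : I g by rewrite Ig; exists 1 => //; rewrite mul1r.
have [u hu ug] : [set h * g | h in H]%classic n%:R%:A.
  by rewrite -Ig; exists 0, 1; split=> //; rewrite mul0r add0r.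
have [w hw wg] : [set h * g | h in H]%classic (n%:R *: rho).
  by rewrite -Ig; exists 1, 0; split=> //; rewrite mul1r scaler0 addr0.
have NE : qnorm u * qnorm g = n%:R ^+ 2.
  by rewrite -qnorm_mul ug qnorm_scale qnorm1 mulr1.
have [nu nuE] := order_qnorm_nat hH hu.
have nu0 : nu != 0%N.
  by apply: contra_eq_neq NE => nu0; rewrite nuE nu0 mul0r eq_sym expf_neq0.
(* If [u] had norm 1, [qconj u] would invert it; then [g = n * qconj u], and [n * rho = w * g] would
   put [rho = w * qconj u] in [H]. *)
have nu1 : nu != 1%N.
  apply/eqP => nu1; apply: nrho.
  have gu : g = n%:R *: qconj u.
    have := congr1 (fun x => qconj u * x) ug.
    by rewrite mulrA mulq_conjl nuE nu1 scale1r mul1r -scalerAr mulr1.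
  suff -> : rho = w * qconj u by apply: subringM => //; exact: order_conj.
  by apply: (scalerI nn0); rewrite -wg gu scalerAr.
have nu2 : 2 <= nu%:R :> rat by rewrite ler_nat; case: nu nu0 nu1 {nuE} => [|[|]].
have gpos : 0 < qnorm g.
  apply: division_qnorm_gt0 => //; apply/eqP => g0.
  have := congr1 (@q0 a b) ug; rewrite g0 mulr0 /= mulr1 => /esym/eqP.
  by rewrite (negPf nn0).
(* The element [h * rho + k = g / n] has norm [N(g) / n^2 = 1 / N(u)], at most 1/2. *)
exists h, (- k); split=> //; first exact: subringN.
have -> : h * rho - - k = n%:R^-1 *: g.
  by rewrite gE opprK scalerDr scalerAr !scalerA mulVf // !scale1r.
rewrite qnorm_scale exprVn mulr_gt0 ?invr_gt0 ?exprn_even_gt0 //=.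
rewrite mulrC ltr_pdivrMr ?exprn_even_gt0 // mul1r -NE nuE.
by rewrite ltr_pMl //; apply: lt_le_trans nu2.
Qed.

(* qconj delta * delta / p is a rational number that is not an integer. *)
Lemma norm_reducible_coprime (p n : nat) delta : (0 < p)%N -> H delta ->
  qnorm delta = n%:R -> ~~ (p %| n)%N -> norm_reducible H ((p%:R : rat)^-1 *: delta).
Proof.
move=> p0 hd dn pn; have p0' : p%:R != 0 :> rat by rewrite pnatr_eq0 -lt0n.
(* Subtracting the integer quotient leaves the scalar [(n mod p) / p], strictly between 0 and 1. *)
exists (qconj delta), ((n %/ p)%N%:R%:A); split.
- exact: order_conj.
- exact: order_natr.
have -> : qconj delta * (p%:R^-1 *: delta) - (n %/ p)%N%:R%:A = ((n %% p)%N%:R / p%:R)%:A.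
  rewrite -scalerAr mulq_conjl dn scalerA -scalerBl; congr (_ *: _).
  by rewrite {1}(divn_eq n p) natrD natrM; field.
have r0 : 0 < (n %% p)%N%:R / p%:R :> rat by rewrite divr_gt0 ?ltr0n // lt0n.
rewrite qnorm_scale qnorm1 mulr1 exprn_gt0 //= exprn_ilt1 ?ltW //.
by rewrite ltr_pdivrMr ?ltr0n // mul1r ltr_nat ltn_mod.
Qed.

End DedekindHasse.

(** * Primes beyond the cube *)

Lemma max_abs_ge (m n : nat) (c : 'M[rat]_(m, n)) r s : `|c r s| <= max_abs c.
Proof.
rewrite /max_abs (bigmaxD1 r) //= le_max; apply/orP; left.
by rewrite (bigmaxD1 s) //= le_max lexx.
Qed.

(** The complement of the range in the theorem is [L ^ 3 <= p], while the approximation argument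
    needs [L ^ 3 < p]. *)
Lemma prime_neq_cube (L : nat) : ~~ prime (L ^ 3).
Proof.
apply/negP => /primeP[L1 /(_ L)]; rewrite dvdn_exp // => /(_ isT).
case: L L1 => [|[|L]] //= _ => /eqP; rewrite -[X in X = _]expn1.
by move/eqP; rewrite eqn_exp2l.
Qed.

Section LargePrimes.
Variables (R : realType) (a b : nat) (H : set (quat a b)).
Hypotheses (hdiv : division_ring (quat a b)) (hH : is_order H).
Variables (c : 'M[rat]_(3, 4)) (v : 'I_3 -> quat a b).
Hypothesis hv : forall r : 'I_3, v r = (c r (inord 0))%:A + c r (inord 1) *: qi a b
                             + c r (inord 2) *: qj a b + c r (inord 3) *: qk a b.
Hypothesis hbasis : zbasis H (with_one v).

Lemma zbasis_mem z : H (zcomb (with_one v) z).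
Proof. by case: hbasis => -> _; exists z. Qed.

(** Otherwise [v ord0] would be 0, against freeness of the basis. Positivity makes the ceiling [L]
    positive and lets [M] be cancelled in the estimates. *)
Lemma max_abs_basis_gt0 : 0 < max_abs c.
Proof.
rewrite ltNge; apply/negP => M0; have [_ hfree] := hbasis.
have c0 s : c ord0 s = 0.
  by apply/eqP; rewrite -normr_le0; apply: le_trans M0; exact: max_abs_ge.
have v0 : v ord0 = 0 by rewrite hv !c0 !scale0r !addr0.
pose z (i : 'I_4) : int := (i == lift ord0 ord0)%:R.
have /hfree/(_ (lift ord0 ord0)) : zcomb (with_one v) z = 0.
  rewrite /zcomb (bigD1 (lift ord0 ord0)) //= big1 ?addr0 => [|i /negPf hi].
    by rewrite /with_one liftK v0 mul0rz.
  by rewrite /z hi mulr0z.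
by rewrite /z eqxx.
Qed.

(* Dirichlet's theorem is applied to the last three coordinates only: the first
   one is made at most 1/2 in absolute value by subtracting an integer. *)
Lemma norm_reducible_large_prime (p : nat) (z : 'I_4 -> int) (L : nat) :
  let d := ((1 + a) * (1 + b))%N in
  prime p -> (0 < L)%N -> (L ^ 3 < p)%N ->
  2 * ratr (max_abs c) * (1 + Num.sqrt (1 + 3 * d%:R)) <= L%:R :> R ->
  let rho := (p%:R : rat)^-1 *: zcomb (with_one v) z in
  ~ H rho -> norm_reducible H rho.
Proof.
move=> d pp L0 Lp hL rho nrho; have [hs _ _] := hH; have [h1 hB _] := hs.
have p0 : p%:R != 0 :> rat by rewrite pnatr_eq0 -lt0n prime_gt0.
pose f (i : 'I_3) : rat := (z (lift ord0 i))%:~R / p%:R.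
have [q [m [/andP[q_gt0 qL] hm]]] := dirichlet_simultaneous f L0.
pose x0 : rat := q%:R * ((z ord0)%:~R / p%:R).
pose m0 := Num.floor (x0 + 2^-1).
pose m' (i : 'I_4) : int := if unlift ord0 i is Some j then m j else m0.
pose r (i : 'I_3) := q%:R * f i - (m i)%:~R.
pose r0 := x0 - m0%:~R.
have r0_le : `|r0| <= 2^-1.
  have /andP[] := floor_itv (x0 + 2^-1); rewrite -/m0 rmorphD /= => l1 l2.
  by rewrite ler_norml /r0; apply/andP; split; lra.
pose y := (q%:R : rat)%:A * rho - zcomb (with_one v) m'.
have yE : y = r0%:A + \sum_(i < 3) r i *: v i.
  rewrite /y /rho /zcomb !big_ord_recl [in LHS]big_ord0 /with_one /m' !unlift_none !liftK.
  rewrite !big_ord0 !addr0 -scalerAl mul1r scalerA -!scaler_int /r /r0 /x0 /f.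
  by apply: quatP; split; rewrite /=; field.
(* As [0 < q < p], Bezout gives [u q + w p = 1], so [rho = u (q rho) + w (p rho)] with [p rho] in
   [H]. This makes [y] nonzero below. *)
have nH : ~ H ((q%:R : rat) *: rho).
  have /coprimezP[[u w] /= uw] : coprimez q p.
    rewrite /coprimez /gcdz !absz_nat eqz_nat -/(coprime q p).
    rewrite coprime_sym prime_coprime //.
    by apply/negP => /(dvdn_leq q_gt0); rewrite leqNgt (leq_ltn_trans qL Lp).
  move=> hq; apply: nrho.
  have -> : rho = u%:~R *: (q%:R *: rho) + w%:~R *: zcomb (with_one v) z.
    rewrite -[X in _ = _ + X *: _](mulfK p0).
    rewrite -[_ *: zcomb _ _]scalerA -/rho scalerA -scalerDl.
    rewrite -[LHS]scale1r; congr (_ *: _).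
    by move/(congr1 (fun k : int => k%:~R : rat)): uw; rewrite rmorphD !rmorphM.
  by apply: subringD => //; apply: order_int_scale => //; exact: zbasis_mem.
exists ((q%:R : rat)%:A), (zcomb (with_one v) m'); split.
- exact: order_natr.
- exact: zbasis_mem.
rewrite -/y; apply/andP; split.
  apply: division_qnorm_gt0 => //; apply/eqP => y0; apply: nH.
  have := zbasis_mem m'.
  by move/eqP: y0; rewrite /y -scalerAl mul1r subr_eq0 => /eqP <-.
(* This bounds the contribution of the [r i] to each of the four coordinates of [y]; as every [r i]
   is below [1 / L] in absolute value, it is less than [3 M / L]. *)
pose t := (`|r ord0| + `|r (lift ord0 ord0)| +
  `|r (lift ord0 (lift ord0 ord0))|) * max_abs c.
have M0 := max_abs_basis_gt0.
have t0 : 0 <= t by rewrite mulr_ge0 ?addr_ge0 // ltW.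
have tL : t * L%:R < 3 * max_abs c.
  have hr i : `|r i| * L%:R < 1 by rewrite -ltr_pdivlMr ?ltr0n // div1r; exact: hm.
  rewrite /t mulrAC ltr_pM2r // !mulrDl.
  by have := hr ord0; have := hr (lift ord0 ord0);
    have := hr (lift ord0 (lift ord0 ord0)); lra.
have qt s : `|\sum_(i < 3) r i * c i s| <= t.
  apply: (le_trans (ler_norm_sum _ _ _)).
  rewrite !big_ord_recl big_ord0 addr0 !normrM addrA /t !mulrDl.
  by rewrite !lerD // ler_wpM2l // max_abs_ge.
have coord0 : q0 y = r0 + \sum_(i < 3) r i * c i (inord 0).
  by rewrite yE !big_ord_recl !big_ord0 !hv /=; ring.
have coord1 : q1 y = \sum_(i < 3) r i * c i (inord 1).
  by rewrite yE !big_ord_recl !big_ord0 !hv /=; ring.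
have coord2 : q2 y = \sum_(i < 3) r i * c i (inord 2).
  by rewrite yE !big_ord_recl !big_ord0 !hv /=; ring.
have coord3 : q3 y = \sum_(i < 3) r i * c i (inord 3).
  by rewrite yE !big_ord_recl !big_ord0 !hv /=; ring.
apply: (@qnorm_lt1 _ _ y t); rewrite ?coord0 ?coord1 ?coord2 ?coord3 //.
  by apply: (le_trans (ler_normD _ _)); rewrite lerD.
exact: quadratic_lt_of_sqrt_bound M0 t0 tL hL.
Qed.

End LargePrimes.

(** * Reduction to quotients [delta / p] with [delta] reduced modulo [p] *)

Theorem theorem4p9 (R : realType) (a b : nat)
    (hdiv : division_ring (quat a b))
    (H : set (quat a b)) (hH : is_order H)
    (c : 'M[rat]_(3, 4)) (v : 'I_3 -> quat a b)
    (hv : forall r : 'I_3, v r = (c r (inord 0))%:A + c r (inord 1) *: qi a b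
                               + c r (inord 2) *: qj a b + c r (inord 3) *: qk a b)
    (hbasis : zbasis H (with_one v)) :
  let d : nat := ((1 + a) * (1 + b))%N in
  let M : rat := max_abs c in
  left_PID H <->
  (forall p : nat, prime p ->
     (p%:Z < Num.ceil (2 * ratr M * (1 + Num.sqrt (1 + 3 * d%:R)) : R) ^+ 3) ->
   forall z : 'I_4 -> int,
     let delta : quat a b := zcomb (with_one v) z in
     delta != 0 ->
     0 <= z ord0 ->
     (forall i : 'I_4, `|z i|%:~R <= p%:R / 2 :> rat) ->
     (exists m : int, qnorm delta = (p%:Z * m)%:~R) ->
     let rho : quat a b := (p%:R : rat)^-1 *: delta in
     exists (w : 'I_4 -> int) (beta : quat a b),
       let alpha : quat a b := zcomb (with_one v) w in
       [/\ forall i : 'I_4, `|w i|%:~R <= p%:R / 2 :> rat,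
           H beta
         & 0 < qnorm (alpha * rho - beta) < 1]).
Proof.
move=> d M; have [hs _ _] := hH; have [h1 hB hM] := hs.
have hz := zbasis_mem hbasis.
split=> [hP p pp _ z delta delta0 _ hzp _ rho|hyp].
  have p0 : p%:R != 0 :> rat by rewrite pnatr_eq0 -lt0n prime_gt0.
  have prho : p%:R *: rho = delta by rewrite scalerA mulfV // scale1r.
  (* If [rho] were in [H], every [z i] would be a multiple of [p] of size at most [p / 2], hence 0,
     against [delta != 0]. *)
  have nrho : ~ H rho.
    have [HE _] := hbasis; rewrite HE => -[k _ hk]; case/eqP: delta0.
    have zk : zcomb (with_one v) (fun i => p%:Z * k i) = zcomb (with_one v) z.
      by rewrite zcombM hk -scaler_int -[RHS]prho.
    rewrite /delta /zcomb big1 // => i _; have := zcomb_inj hbasis zk i.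
    have := hzp i; rewrite ler_pdivlMr // -[2]/(2%:~R) -intrM -[p%:R]/(p%:~R) ler_int.
    have p1 := prime_gt1 pp => zi ki; suff -> : z i = 0 by rewrite mulr0z.
    move: zi; rewrite -ki; have [->|k0] := eqVneq (k i) 0; first by rewrite mulr0.
    rewrite normrM (ger0_norm (isT : 0 <= p%:Z)).
    have : p%:Z * 1 <= p%:Z * `|k i| by rewrite ler_wpM2l // -gtz0_ge1 normr_gt0.
    lia.
  have [|al [be [hal hbe hN]]] :=
    norm_reducible_of_left_PID hdiv hH hP (prime_gt0 pp) _ nrho.
    by rewrite prho; exact: hz.
  have [HE _] := hbasis; have [w0 _ w0E] : range (zcomb (with_one v)) al by rewrite -HE.
  have [k hk] := choice (fun i => centered_modE p (w0 i)).
  (* Reducing [al] modulo [p] changes [al * rho] by a left multiple of [delta] in [H], which the new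
     [beta] absorbs. *)
  exists (fun i => centered_mod p (w0 i)), (be - zcomb (with_one v) k * delta).
  split; first by move=> i; apply: centered_mod_le; exact: prime_gt0.
    by apply: hB => //; apply: hM; exact: hz.
  suff -> : zcomb (with_one v) (fun i => centered_mod p (w0 i)) * rho -
    (be - zcomb (with_one v) k * delta) = al * rho - be by [].
  have -> : al = zcomb (with_one v) (fun i => centered_mod p (w0 i)) +
      p%:R *: zcomb (with_one v) k.
    rewrite -w0E -[p%:R]/(p%:~R) scaler_int -zcombM -zcombD; congr zcomb.
    exact/funext.
  by rewrite mulrDl -scalerAl scalerAr prho opprB addrA.
apply: left_PID_of_norm_reducible => // rho nrho.
have [p [m [pp nx]]] := order_prime_denominator hH nrho.
set x := m%:R *: rho; have [HE _] := hbasis; rewrite {1}HE => -[z0 _ z0E].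
have p0 : p%:R != 0 :> rat by rewrite pnatr_eq0 -lt0n prime_gt0.
have [k hk] := choice (fun i => centered_modE p (z0 i)).
(* The sign makes the first coordinate nonnegative, as the hypothesis demands, and preserves the
   bounds [p / 2]. *)
pose s : int := if 0 <= centered_mod p (z0 ord0) then 1 else -1.
have s1 : s * s = 1 by rewrite /s; case: ifP.
pose z i := s * centered_mod p (z0 i).
pose delta := zcomb (with_one v) z.
pose x' := (p%:R : rat)^-1 *: delta.
have xE : x = s%:~R *: x' + zcomb (with_one v) k.
  apply: (scalerI p0); rewrite scalerDr [p%:R *: (s%:~R *: _)]scalerA mulrC -scalerA.
  rewrite /x' [p%:R *: (_ *: delta)]scalerA mulfV // scale1r /delta !scaler_int.
  rewrite -[p%:R *: zcomb _ _]/(p%:~R *: zcomb _ _) scaler_int -!zcombM -zcombD.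
  rewrite -z0E; congr zcomb.
  by apply/funext => i; rewrite /z mulrA s1 mul1r.
have nx' : ~ H x'.
  by move=> hx'; apply: nx; rewrite -/x xE; apply: subringD => //; exact: order_int_scale.
have x'E : x' = (s%:~R * m%:R)%:A * rho + (- (s%:~R *: zcomb (with_one v) k)).
  rewrite -scalerAl mul1r -[(_ * _) *: rho]scalerA -/x xE scalerDr addrK.
  by rewrite scalerA -rmorphM s1 scale1r.
(* By [x'E], [x'] is an integer multiple of [rho] translated by [H]. *)
suff : norm_reducible H x'.
  rewrite x'E; apply: norm_reducible_affine => //.
    by rewrite -scalerA; apply: order_int_scale => //; exact: order_natr.
  by apply: subringN => //; exact: order_int_scale.
have [n hn] := order_qnorm_nat hH (hz z).
have [/dvdnP[n' nE]|pn] := boolP (p %| n)%N; last first.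
  exact: (norm_reducible_coprime hH (prime_gt0 pp) (hz z) hn pn).
set C := Num.ceil (2 * ratr M * (1 + Num.sqrt (1 + 3 * d%:R)) : R).
have [pC|pC] := ltP p%:Z (C ^+ 3).
  have [||||w [be [_ hbe hN]]] := hyp p pp pC z.
  - by apply/eqP => z00; apply: nx'; rewrite /x' /delta z00 scaler0; exact: subring0.
  - by rewrite /z /s; case: ifP => [|/negbT]; lia.
  - move=> i; rewrite normrM (_ : `|s| = 1) ?mul1r; last by rewrite /s; case: ifP.
    by apply: centered_mod_le; exact: prime_gt0.
  - by exists n'%:Z; rewrite hn nE mulnC.
  by exists (zcomb (with_one v) w), be; split.
have M0 : 0 < M := max_abs_basis_gt0 hv hbasis.
have X0 : 0 < 2 * ratr M * (1 + Num.sqrt (1 + 3 * d%:R)) :> R.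
  by apply: mulr_gt0; [rewrite mulr_gt0 ?ltr0q | apply: ltr_pwDl; rewrite ?sqrtr_ge0].
have C0 : 0 < C by rewrite -(ltr_int R); apply: lt_le_trans X0 (ceil_ge _).
have CE : C = `|C|%N%:Z by rewrite gtz0_abs.
(* The ceiling [C] serves as [L]. *)
apply: (@norm_reducible_large_prime R _ _ _ hdiv hH c v hv hbasis p z `|C|%N) => //.
- by rewrite absz_gt0 gt_eqF.
- rewrite ltn_neqAle; apply/andP; split.
    by apply: contraTneq pp => <-; exact: prime_neq_cube.
  by rewrite -lez_nat -abszX gez0_abs ?exprn_ge0 // ltW.
by apply: le_trans (ceil_ge _) _; rewrite -/C [in X in X <= _]CE.
Qed.
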